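(* Let $(d;\boldsymbol{m})\in\mathcal{E}$ with $d\ge1$, and let $a\ge1$ be rational such that $\ell(\boldsymbol{m})=\ell(a)=:M$ and $\mu(d;\boldsymbol{m})(a)>\sqrt a$. Write $a=p/q$ in lowest terms, let $m:=m_M$ be the last nonzero entry of $\boldsymbol{m}$, and let $I$ be the connected component of the set $\{z\ge 1:\mu(d;\boldsymbol{m})(z)>\sqrt z\}$ that contains $a$. Then there are integers $A<p$ and $B<(m+1)q$ such that $$d\,\mu(d;\boldsymbol{m})(z)=\begin{cases}A+Bz&\text{if }z<a,\ z\in I,\\ (A+mp)+(B-mq)z&\text{if }z>a,\ z\in I.\end{cases}$$
   Context: Weight expansion: for real $a\ge1$ put $x_{-1}=a$, $x_0=1$, and while $x_j>0$ put $\ell_j=\lfloor x_{j-1}/x_j\rfloor$, $x_{j+1}=x_{j-1}-\ell_jx_j$. Then $\boldsymbol{w}(a)=(w_1(a),w_2(a),\dots)=(1^{\times\ell_0},x_1^{\times\ell_1},x_2^{\times\ell_2},\dots)$, where $x^{\times\ell}$ means $x$ repeated $\ell$ times; it is finite if $a$ is rational and infinite otherwise. $\ell(a)\in\mathbb{N}\cup\{\infty\}$ is the number of entries of $\boldsymbol{w}(a)$. For a tuple $\boldsymbol{m}$, $\ell(\boldsymbol{m})$ is the number of positive entries. For $d\ge1$, $\mu(d;\boldsymbol{m})(z)=\frac1d\sum_im_iw_i(z)$, missing entries being taken to be $0$. The set $\mathcal{E}$: let $X_M$ be the $M$-fold blow up of $\mathbb{C}P^2$ with a symplectic form $\omega_M$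 obtained by blow-up from the standard form, and $L,E_1,\dots,E_M\in H_2(X_M;\mathbb{Z})$ the classes of the line and the exceptional divisors. $\mathcal{E}_M$ is the set consisting of $(0;-1,0,\dots,0)$ and of all tuples $(d;m_1,\dots,m_M)$ of nonnegative integers with $m_1\ge\dots\ge m_M$ such that $dL-\sum_im_iE_i$ is represented in $(X_M,\omega_M)$ by a symplectically embedded sphere of self-intersection $-1$ (independent of the choice of $\omega_M$). $\mathcal{E}=\bigcup_M\mathcal{E}_M$, where $\mathcal{E}_M\subset\mathcal{E}_{M'}$ for $M\le M'$ by adding zeros. *)

(* Defs.v *)
From HB Require Import structures.
From mathcomp Require Import all_boot all_order all_algebra.
From mathcomp Require Import all_classical all_reals all_analysis.

Set Implicit Arguments.
Unset Strict Implicit.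
Unset Printing Implicit Defensive.

Import Order.TTheory GRing.Theory Num.Theory.
Import numFieldNormedType.Exports.

Local Open Scope classical_set_scope.
Local Open Scope ring_scope.

(* Everything is over an arbitrary R : realType.

   The set E of exceptional classes is defined geometrically.
   - CP^2 is the unit sphere S^5 of C^3 modulo the unit circle.  The standard
     form is the one whose pullback to S^5 is the restriction of the standard
     form of C^3, so a line has area pi.
   - A blow up of (CP^2, standard form) is the complement of the interiors of
     M disjoint symplectically embedded closed balls, with every boundary
     sphere collapsed along its Hopf circles.  It is realised as a subset of
     some R^N (no loss of generality, by Whitney's embedding theorem).
   - H_2 is singular homology with integer coefficients, in its cubical form. *)

Section WeightExpansion.
Variable R : realType.
Implicit Types (a z : R).

(* The pair (x_{j-1}, x_j); after the last positive x_j everything is 0. *)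
Fixpoint weight_state a (j : nat) : R * R :=
  if j is j'.+1 then
    let: (u, v) := weight_state a j' in
    (v, if 0 < v then u - (Num.truncn (u / v))%:R * v else 0)
  else (a, 1).

Definition weight_x a (j : nat) : R := (weight_state a j).2.

Definition weight_l a (j : nat) : nat :=
  if 0 < weight_x a j
  then Num.truncn ((weight_state a j).1 / weight_x a j) else 0%N.

(* Entry number i (counted from 0), and 0 for a missing entry.  For a >= 1 every
   block before the end is nonempty, so i.+1 blocks are enough to reach it. *)
Definition weight a (i : nat) : R :=
  nth 0 (flatten [seq nseq (weight_l a j) (weight_x a j) | j <- iota 0 i.+1]) i.

(* The number of entries of the weight expansion; None stands for infinity. *)
Definition weight_length a : option nat :=
  match pselect (exists J, weight_x a J == 0) with
  | left finite_exp => Some (\sum_(j < ex_minn finite_exp) weight_l a j)%N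
  | right _ => None
  end.

Definition tuple_length (m : seq int) : nat := count (fun k : int => 0 < k) m.

Definition mu (d : int) (m : seq int) z : R :=
  (d%:~R)^-1 * \sum_(i < size m) (m`_i)%:~R * weight z i.

End WeightExpansion.

Section Coordinates.
Variable R : realType.
Local Notation C := (R * R)%type.
Local Notation C2 := (C * C)%type.
Local Notation C3 := (C * C * C)%type.

Definition cmul (a b : C) : C := (a.1 * b.1 - a.2 * b.2, a.1 * b.2 + a.2 * b.1).
Definition sqabs (a : C) : R := a.1 ^+ 2 + a.2 ^+ 2.
Definition cis (t : R) : C := (cos t, sin t).
(* The direction s / |s|, with the convention 1 at s = 0. *)
Definition direction (s : C) : C :=
  if s == 0 then (1, 0) else (Num.sqrt (sqabs s))^-1 *: s.

Definition cmul2 (c : C) (z : C2) : C2 := (cmul c z.1, cmul c z.2).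
Definition sqnorm2 (z : C2) : R := sqabs z.1 + sqabs z.2.
Definition swap2 (z : C2) : C2 := (z.2, z.1).

Definition cmul3 (c : C) (v : C3) : C3 :=
  (cmul c v.1.1, cmul c v.1.2, cmul c v.2).
Definition sqnorm3 (v : C3) : R := sqabs v.1.1 + sqabs v.1.2 + sqabs v.2.
Definition cdot (a b : C) : R := a.1 * b.1 + a.2 * b.2.
Definition realdot3 (v w : C3) : R :=
  cdot v.1.1 w.1.1 + cdot v.1.2 w.1.2 + cdot v.2 w.2.

Definition omega1 (a b : C) : R := a.1 * b.2 - a.2 * b.1.
Definition omega2 (z w : C2) : R := omega1 z.1 w.1 + omega1 z.2 w.2.
Definition omega3 (v w : C3) : R :=
  omega1 v.1.1 w.1.1 + omega1 v.1.2 w.1.2 + omega1 v.2 w.2.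

(* Nonzero vectors of C^3 as homogeneous coordinates of the same point. *)
Definition same_point (v w : C3) : Prop := exists2 c : C, c != 0 & w = cmul3 c v.

(* C^infinity on an open set U: all iterated directional derivatives exist
   and are differentiable. *)
Definition smooth_on (V W : normedModType R) (U : set V) (f : V -> W) : Prop :=
  forall (vs : seq V) (x : V), U x ->
    differentiable (foldr (fun v g => fun y => 'D_v g y) f vs) x.

Definition eval_form (N : nat) (B : 'M[R]_N) (u v : 'rV[R]_N) : R :=
  (u *m B *m v^T) 0 0.

End Coordinates.

Section Homology.
Variable R : realType.

Definition unit_square : set (R * R) :=
  [set x | 0 <= x.1 <= 1 /\ 0 <= x.2 <= 1].
Definition unit_cube : set (R * R * R) :=
  [set x | [/\ 0 <= x.1.1 <= 1, 0 <= x.1.2 <= 1 & 0 <= x.2 <= 1]].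

Variable T : topologicalType.

(* Formal integral combinations of singular squares; only the restrictions of
   squares and cubes to the unit square and the unit cube matter. *)
Definition chain2 := seq (int * (R * R -> T)).

Definition coef (c : chain2) (s : R * R -> T) : int :=
  \sum_(p <- c | `[< forall x, unit_square x -> p.2 x = s x >]) p.1.

Definition degenerate (s : R * R -> T) : Prop :=
  (forall x, unit_square x -> s x = s (0, x.2)) \/
  (forall x, unit_square x -> s x = s (x.1, 0)).

Definition boundary_cube (k : R * R * R -> T) : chain2 :=
  [:: (-1, fun x => k (0, x.1, x.2)); (1, fun x => k (1, x.1, x.2));
      (1, fun x => k (x.1, 0, x.2)); (-1, fun x => k (x.1, 1, x.2));
      (-1, fun x => k (x.1, x.2, 0)); (1, fun x => k (x.1, x.2, 1))].

Definition boundary (n : nat) (b : 'I_n -> int) (k : 'I_n -> R * R * R -> T) :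
    chain2 :=
  flatten [seq [seq (b i * p.1, p.2) | p <- boundary_cube (k i)]
          | i <- enum 'I_n].

(* Equality of c and c' in H_2(X; Z): modulo degenerate squares (as always in
   cubical singular homology), c - c' is the boundary of a 3-chain of X. *)
Definition homologous (X : set T) (c c' : chain2) : Prop :=
  exists (n : nat) (b : 'I_n -> int) (k : 'I_n -> R * R * R -> T),
    (forall i, {within unit_cube, continuous (k i)} /\
               (forall x, unit_cube x -> X (k i x))) /\
    (forall s, ~ degenerate s -> coef c s = coef (c' ++ boundary b k) s).

End Homology.

Section BlowUp.
Variable R : realType.
Local Notation C := (R * R)%type.
Local Notation C2 := (C * C)%type.
Local Notation C3 := (C * C * C)%type.

(* Lift to S^5 of a symplectic embedding into CP^2 of the open ball of radius
   rho in C^2.  Every embedding of a ball has such a lift. *)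
Definition symplectic_ball (rho : R) (phi : C2 -> C3) : Prop :=
  let ball := [set z : C2 | sqnorm2 z < rho ^+ 2] in
  [/\ smooth_on ball phi,
      forall z, ball z -> sqnorm3 (phi z) = 1,
      forall z u v, ball z ->
        omega3 ('D_u phi z) ('D_v phi z) = omega2 u v &
      forall z z', ball z -> ball z' -> same_point (phi z) (phi z') -> z = z'].

(* Near the exceptional sphere, a point with coordinates (b, s), s <> 0,
   corresponds to the point (sqrt (r^2 + |s|^2 - |b|^2) s/|s|, b s/|s|) of C^2,
   of norm sqrt (r^2 + |s|^2) > r.  In polar coordinates one checks that this
   is symplectic.  The points (b, 0) correspond to the Hopf circles of the
   sphere of radius r on which the first coordinate does not vanish. *)
Definition cut_chart (r : R) (p : C2) : C2 :=
  let: (b, s) := p in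
  (Num.sqrt (r ^+ 2 + sqabs s - sqabs b) *: direction s, cmul b (direction s)).

Definition cut_domain (r rho : R) : set C2 :=
  [set p | sqabs p.1 < r ^+ 2 + sqabs p.2 /\ r ^+ 2 + sqabs p.2 < rho ^+ 2].

(* f pulls the form omega back to the standard form of C^2 on U; in particular
   f is then an immersion. *)
Definition darboux (N : nat) (omega : 'rV[R]_N -> 'M[R]_N) (U : set C2)
    (f : C2 -> 'rV[R]_N) : Prop :=
  smooth_on U f /\
  forall p u v, U p ->
    eval_form (omega (f p)) ('D_u f p) ('D_v f p) = omega2 u v.

(* M-fold symplectic blow up X of (CP^2, standard form), along balls of radii
   bu_r i.  The map bu_proj, written in homogeneous coordinates, is the quotient
   map from CP^2 minus the open balls onto X.  The value of bu_form at a point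
   of X is only meaningful on tangent vectors to X; that it is smooth, closed
   and nondegenerate there follows from the Darboux charts. *)
Record blowup (M : nat) := Blowup {
  bu_dim : nat;
  bu_r : 'I_M -> R;
  bu_rho : 'I_M -> R;
  bu_ball : 'I_M -> C2 -> C3;
  bu_proj : C3 -> 'rV[R]_bu_dim;
  bu_form : 'rV[R]_bu_dim -> 'M[R]_bu_dim;

  bu_outside : set C3 := [set v | v != 0 /\
    forall i z, sqnorm2 z < bu_r i ^+ 2 -> ~ same_point v (bu_ball i z)];
  bu_interior : set C3 := [set v | v != 0 /\
    forall i z, sqnorm2 z <= bu_r i ^+ 2 -> ~ same_point v (bu_ball i z)];

  bu_radii : forall i, 0 < bu_r i < bu_rho i;
  bu_ballP : forall i, symplectic_ball (bu_rho i) (bu_ball i);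
  bu_disjoint : forall i j z z', i != j ->
    sqnorm2 z < bu_rho i ^+ 2 -> sqnorm2 z' < bu_rho j ^+ 2 ->
    ~ same_point (bu_ball i z) (bu_ball j z');

  bu_continuous : {within bu_outside, continuous bu_proj};
  bu_fibres : forall v v', bu_outside v -> bu_outside v' ->
    (bu_proj v = bu_proj v' <->
     same_point v v' \/
     exists i z c, [/\ sqnorm2 z = bu_r i ^+ 2, sqabs c = 1,
                       same_point v (bu_ball i z) &
                       same_point v' (bu_ball i (cmul2 c z))]);
  bu_smooth : smooth_on bu_interior bu_proj;
  bu_symplectic : forall v u w, bu_interior v -> sqnorm3 v = 1 ->
    realdot3 v u = 0 -> realdot3 v w = 0 ->
    eval_form (bu_form (bu_proj v)) ('D_u bu_proj v) ('D_w bu_proj v) =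
      omega3 u w;
  bu_chart1 : forall i, darboux bu_form (cut_domain (bu_r i) (bu_rho i))
    (fun p => bu_proj (bu_ball i (cut_chart (bu_r i) p)));
  bu_chart2 : forall i, darboux bu_form (cut_domain (bu_r i) (bu_rho i))
    (fun p => bu_proj (bu_ball i (swap2 (cut_chart (bu_r i) p))))
}.

Arguments bu_r {M} b i.
Arguments bu_rho {M} b i.
Arguments bu_ball {M} b i z.
Arguments bu_proj {M} b v.
Arguments bu_form {M} b x.
Arguments bu_outside {M} b.
Arguments bu_interior {M} b.

Variables (M : nat) (B : blowup M).

Definition bu_carrier : set 'rV[R]_(bu_dim B) := bu_proj B @` bu_outside B.

(* Lift to S^3 of a singular square [polar_line x] in CP^1 = S^3/S^1, which is
   a cycle modulo degenerate squares and represents the fundamental class for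
   the complex orientation. *)
Definition polar_line (x : R * R) : C2 :=
  ((cos (pi * x.1 / 2), 0), sin (pi * x.1 / 2) *: cis (2 * pi * x.2)).

(* The exceptional divisor: the sphere of radius bu_r i modulo Hopf circles. *)
Definition exceptional_sphere (i : 'I_M) (x : R * R) : 'rV[R]_(bu_dim B) :=
  bu_proj B (bu_ball B i (bu_r B i *: polar_line x)).

(* A representative in X of the class L: a sphere of CP^2 that is disjoint from
   the closed balls and homotopic in CP^2 to a complex line.  Here h lifts the
   homotopy to nonzero vectors of C^3; its parameter is x.1.1. *)
Definition line_sphere (l : R * R -> 'rV[R]_(bu_dim B)) : Prop :=
  exists h : R * R * R -> C3,
    [/\ {within @unit_cube R, continuous h},
        (forall x, unit_cube x -> h x != 0),
        (forall x, unit_square x -> h (0, x.1, x.2) = (polar_line x, 0)),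
        (forall t x, 0 <= t <= 1 -> unit_square x ->
          [/\ same_point (h (t, 0, x.2)) (h (t, 0, 0)),
              same_point (h (t, 1, x.2)) (h (t, 1, 0)) &
              same_point (h (t, x.1, 0)) (h (t, x.1, 1))]) &
        (forall x, unit_square x -> bu_interior B (h (1, x.1, x.2)) /\
                                    l x = bu_proj B (h (1, x.1, x.2)))].

Definition dot_R3 (x y : R * R * R) : R :=
  x.1.1 * y.1.1 + x.1.2 * y.1.2 + x.2 * y.2.
Definition cross_R3 (x y : R * R * R) : R * R * R :=
  (x.1.2 * y.2 - x.2 * y.1.2, x.2 * y.1.1 - x.1.1 * y.2,
   x.1.1 * y.1.2 - x.1.2 * y.1.1).

Definition S2 : set (R * R * R) := [set x | dot_R3 x x = 1].

(* A smooth map on S^2 is given by a smooth extension to R^3 \ 0.  The sphere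
   is oriented as the boundary of the ball, and u preserves orientations. *)
Definition symplectic_sphere (u : R * R * R -> 'rV[R]_(bu_dim B)) : Prop :=
  [/\ smooth_on [set x | x != 0] u,
      (forall x, S2 x -> bu_carrier (u x)),
      (forall x y, S2 x -> S2 y -> u x = u y -> x = y) &
      (forall x v w, S2 x -> dot_R3 x v = 0 -> dot_R3 x w = 0 ->
        0 < dot_R3 x (cross_R3 v w) ->
        0 < eval_form (bu_form B (u x)) ('D_v u x) ('D_w u x))].

(* Colatitude and longitude: the fundamental class of S^2, as a singular
   square that is a cycle modulo degenerate squares. *)
Definition spherical (x : R * R) : R * R * R :=
  (sin (pi * x.1) * cos (2 * pi * x.2), sin (pi * x.1) * sin (2 * pi * x.2),
   cos (pi * x.1)).

Definition represented_by (d : int) (m : M.-tuple int)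
    (u : R * R * R -> 'rV[R]_(bu_dim B)) : Prop :=
  exists2 l, line_sphere l &
    homologous bu_carrier [:: (1, u \o spherical)]
      ((d, l) :: [seq (- tnth m i, exceptional_sphere i) | i <- enum 'I_M]).

End BlowUp.

(* Self-intersection of d L - sum_i m_i E_i: the classes L, E_i are pairwise
   orthogonal, L.L = 1 and E_i.E_i = -1. *)
Definition self_intersection (d : int) (m : seq int) : int :=
  d ^+ 2 - \sum_(k <- m) k ^+ 2.

(* The symplectic form is existentially quantified; the set does not depend on
   it. *)
Definition exceptional_M (R : realType) (M : nat) (d : int) (m : M.-tuple int) :
    Prop :=
  ((0 < M)%N /\ d = 0 /\ m = -1 :: nseq M.-1 0 :> seq int) \/
  [/\ 0 <= d, all (>= 0) m, sorted >=%R m, self_intersection d m = -1 &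
      exists (B : blowup R M) (u : R * R * R -> 'rV[R]_(bu_dim B)),
        symplectic_sphere u /\ represented_by d m u].

(* The union of all exceptional_M, tuples being identified when they differ by
   trailing zeros. *)
Definition exceptional (R : realType) (d : int) (m : seq int) : Prop :=
  exists (M : nat) (m' : M.-tuple int),
    exceptional_M R d m' /\ forall i : nat, m`_i = m'`_i.

(* Main.v *)
(* Only the positivity and monotonicity of m and the relation
   sum m_i^2 = d^2 + 1 are used.  The weights of z are the successive minima
   produced by the subtractive Euclidean algorithm on (z, 1), and the squares of
   the first k of them sum to at most z.  By Cauchy-Schwarz the first M weights
   are therefore positive throughout I; hence no tie occurs before step M, the
   pair reached after M - 1 steps is (b z - c, e - f z) with b e - c f = 1 on all
   of I, and a is the mediant (c + e) / (b + f).
   To the left of a write w_i(z) = alpha_i + beta_i z for i <= M; then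
   |alpha|^2 = c p, |beta|^2 = b q and alpha . beta = - c q.  The error vector
   eps = m - (d / sqrt a) w(a) satisfies |eps| < 1.  Since w(a) . alpha = 0 and
   w(a) . beta = 1 = q w_M(a), this gives A = eps . alpha < p and
   B - m_M q = eps . (beta - q e_M) < q. *)
Require Import Defs.
From mathcomp Require Import all_boot all_order all_algebra.
From mathcomp Require Import all_classical all_reals all_analysis.
From mathcomp Require Import ring lra zify.

Set Implicit Arguments.
Unset Strict Implicit.
Unset Printing Implicit Defensive.

Import Order.TTheory GRing.Theory Num.Theory.
Import numFieldNormedType.Exports.

Local Open Scope classical_set_scope.
Local Open Scope ring_scope.

(** Cauchy-Schwarz: the squares of [G * f i - S * g i] sum to [G * (F * G - S ^+ 2)], and [G > 0] is
    divided out; if [G = 0], every [g i] vanishes. *)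
Lemma sum_mul_sqr_le (R : realFieldType) (n : nat) (f g : nat -> R) :
  (\sum_(i < n) f i * g i) ^+ 2 <=
  (\sum_(i < n) f i ^+ 2) * (\sum_(i < n) g i ^+ 2).
Proof.
set S := \sum_(i < n) f i * g i; set F := \sum_(i < n) f i ^+ 2.
set G := \sum_(i < n) g i ^+ 2.
have F_ge0 : 0 <= F by apply: sumr_ge0 => i _; exact: sqr_ge0.
have G_ge0 : 0 <= G by apply: sumr_ge0 => i _; exact: sqr_ge0.
have [G0|G_neq0] := eqVneq G 0.
  suff -> : S = 0 by rewrite expr0n mulr_ge0.
  apply: big1 => i _; suff /eqP : g i ^+ 2 = 0.
    by rewrite sqrf_eq0 => /eqP ->; rewrite mulr0.
  by apply: (psumr_eq0P _ G0) => // j _; exact: sqr_ge0.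
have G_gt0 : 0 < G by rewrite lt_neqAle eq_sym G_neq0.
have : 0 <= \sum_(i < n) (G * f i - S * g i) ^+ 2.
  by apply: sumr_ge0 => i _; exact: sqr_ge0.
have expand c c' : \sum_(i < n) (c * f i - c' * g i) ^+ 2 =
    c ^+ 2 * F - 2 * c * c' * S + c' ^+ 2 * G.
  rewrite !mulr_sumr -sumrB -big_split /=.
  by apply: eq_bigr => i _; ring.
have -> : \sum_(i < n) (G * f i - S * g i) ^+ 2 = G * (F * G - S ^+ 2).
  by rewrite expand; ring.
by rewrite pmulr_rge0 // subr_ge0.
Qed.

(** * The subtractive Euclidean algorithm on the pair (z, 1) *)

Section SubtractiveEuclid.
Variable R : realType.
Implicit Types (z u v : R) (s t : R * R) (k i : nat).

(** The pair is not reordered, so each branch is a linear map. A tie (x, x) goes to (0, x), and a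
    pair of nonnegative entries one of which is 0 is fixed. *)
Definition eucl_step s : R * R :=
  if s.2 <= s.1 then (s.1 - s.2, s.2) else (s.1, s.2 - s.1).

Definition eucl z k : R * R := iter k eucl_step (z, 1).

Definition eucl_min z k : R := Num.min (eucl z k).1 (eucl z k).2.

Lemma eucl_ge0 z k : 0 <= z -> 0 <= (eucl z k).1 /\ 0 <= (eucl z k).2.
Proof.
move=> z0; elim: k => [|k [x0 y0]] /=; first by split.
by rewrite /eucl_step; case: ifP => /= h; split=> //; lra.
Qed.

Lemma eucl_min_ge0 z k : 0 <= z -> 0 <= eucl_min z k.
Proof. by move=> /(eucl_ge0 k)[x0 y0]; rewrite le_min x0 y0. Qed.

Lemma eucl_min0S z k : 0 <= z -> eucl_min z k = 0 -> eucl_min z k.+1 = 0.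
Proof.
move=> z0; have [x0 y0] := eucl_ge0 k z0.
rewrite /eucl_min /= /eucl_step !minEle.
case: (leP (eucl z k).2) => h1; case: (leP (eucl z k).1) => h2 h3 /=;
  by case: leP => h4 //; lra.
Qed.

Lemma eucl_min0 z k i :
  0 <= z -> (k <= i)%N -> eucl_min z k = 0 -> eucl_min z i = 0.
Proof.
move=> z0 /subnK <-; elim: (i - k)%N => // n IH /IH.
exact: eucl_min0S.
Qed.

(** Cutting the square of side min(x, y) off an x by y rectangle leaves the rectangle of the next
    pair; the areas add up to that of the initial z by 1 rectangle. *)
Lemma eucl_sum_sqr z k :
  \sum_(i < k) eucl_min z i ^+ 2 + (eucl z k).1 * (eucl z k).2 = z.
Proof.
elim: k => [|k IH]; first by rewrite big_ord0 /=; ring.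
rewrite big_ord_recr /= -[RHS]IH -addrA; congr +%R.
rewrite /eucl_min /eucl_step /=; case: (eucl z k) => x y /=.
by case: leP => h /=; ring.
Qed.

Lemma eucl_sum_sqr_le z k : 0 <= z -> \sum_(i < k) eucl_min z i ^+ 2 <= z.
Proof.
move=> z0; have [x0 y0] := eucl_ge0 k z0.
by rewrite -[leRHS](eucl_sum_sqr z k) lerDl mulr_ge0.
Qed.

(** [weight_state] swaps its entries after every block and [eucl_step] does not, so the two are
    compared as unordered pairs. *)
Definition same_pair s t : Prop := s = t \/ s = (t.2, t.1).

Lemma same_pair_min s t :
  same_pair s t -> Num.min s.1 s.2 = Num.min t.1 t.2.
Proof. by case=> -> //=; rewrite minC. Qed.

(** A Euclidean division is a run of single subtractions of v: as long as one more multiple of v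
    fits into u, v is the smaller entry. *)
Lemma same_pair_block s u v k :
  0 <= v -> same_pair s (u, v) -> k%:R * v <= u ->
  same_pair (iter k eucl_step s) (u - k%:R * v, v).
Proof.
move=> v0 s_uv; elim: k => [|k IH] hk /=; first by rewrite mul0r subr0.
have hkv : v <= u - k%:R * v by move: hk; rewrite -natr1 mulrDl mul1r; lra.
have hku : k%:R * v <= u by lra.
have -> : u - k.+1%:R * v = u - k%:R * v - v by rewrite -natr1; ring.
move: (IH hku); move: (u - _ * v) hkv => U hU [] ->; rewrite /eucl_step /=.
  by rewrite hU; left.
(* In the reversed order the first branch of [eucl_step] is taken only in the tie [U = v]. *)
by case: ifP => h; [left; have -> : U = v by lra | right].
Qed.

End SubtractiveEuclid.

(** * The weights as the successive minima of the algorithm *)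

Section Weights.
Variable R : realType.
Implicit Types (a z : R).

Lemma weight_stateS a j :
  weight_state a j.+1 =
  (weight_x a j, if 0 < weight_x a j
                 then (weight_state a j).1 - (weight_l a j)%:R * weight_x a j
                 else 0).
Proof.
rewrite /weight_l /weight_x /=; case: (weight_state a j) => u v /=.
by case: ltP.
Qed.

Lemma weight_state_ge0 a j : 1 <= a ->
  0 <= (weight_state a j).2 <= (weight_state a j).1.
Proof.
move=> a1; elim: j => [|j IH]; first by rewrite /= ler01.
rewrite weight_stateS /weight_l /weight_x /=.
move: IH; case: (weight_state a j) => u v /= /andP[v0 vu].
case: ltP => [v_gt0|_]; last by rewrite lexx v0.
have uv0 : 0 <= u / v by rewrite divr_ge0 // (le_trans v0).
have /andP[] := truncn_itv uv0.
rewrite ler_pdivlMr // ltr_pdivrMr // -natr1 mulrDl mul1r => h1 h2.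
by apply/andP; split; lra.
Qed.

Lemma weight_l_itv a j : 1 <= a -> 0 < weight_x a j ->
  (0 < weight_l a j)%N /\
  (weight_l a j)%:R * weight_x a j <= (weight_state a j).1.
Proof.
move=> a1 x0; rewrite /weight_l x0; have := weight_state_ge0 j a1.
move: x0; rewrite /weight_x; case: (weight_state a j) => u v /= v0 /andP[_ vu].
split; first by rewrite truncn_gt0 ler_pdivlMr // mul1r.
by rewrite -ler_pdivlMr // truncn_le divr_ge0 // ltW // (lt_le_trans v0).
Qed.

Definition weight_blocks a n : seq R :=
  flatten [seq nseq (weight_l a j) (weight_x a j) | j <- iota 0 n].

Lemma weight_blocksS a n :
  weight_blocks a n.+1 =
  weight_blocks a n ++ nseq (weight_l a n) (weight_x a n).
Proof.
by rewrite /weight_blocks -addn1 iotaD map_cat flatten_cat /= cats0.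
Qed.

Lemma size_weight_blocks a n :
  size (weight_blocks a n) = (\sum_(j < n) weight_l a j)%N.
Proof.
elim: n => [|n IH]; first by rewrite big_ord0.
by rewrite weight_blocksS size_cat size_nseq IH big_ord_recr.
Qed.

(** Induction over blocks: the block of x_n is a run of subtractions whose minimum is x_n. The bound
    [n <= size] holds because no block before the end is empty; it ensures that i.+1 blocks reach
    entry i unless the expansion has ended. *)
Lemma weight_blocks_eucl a n : 1 <= a ->
  (forall i, (i < size (weight_blocks a n))%N ->
     nth 0 (weight_blocks a n) i = eucl_min a i) /\
  if 0 < weight_x a n
  then (n <= size (weight_blocks a n))%N /\
       same_pair (eucl a (size (weight_blocks a n))) (weight_state a n)
  else eucl_min a (size (weight_blocks a n)) = 0.
Proof.
move=> a1; elim: n => [|n [IHi IHn]].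
  by rewrite /weight_x /= ltr01; split => // ; split => //; left.
have := weight_state_ge0 n a1; rewrite weight_blocksS size_cat size_nseq.
have := @weight_l_itv a n a1; have -> : weight_x a n.+1 = (weight_state a n.+1).2 by [].
rewrite weight_stateS /= -/(weight_x a n).
move: IHn; set s := size _; case: ltP => [x0|x0]; last first.
  rewrite /weight_l ltNge x0 /= addn0 cats0 ltxx => s0 _ _; split=> //.
move=> [ns sn] /(_ isT) [l0 lx] xu.
have block k : (k <= weight_l a n)%N -> same_pair (eucl a (s + k))
    ((weight_state a n).1 - k%:R * weight_x a n, weight_x a n).
  move=> kl; rewrite /eucl addnC iterD; apply: same_pair_block; first exact: ltW.
    by move: sn; rewrite /eucl /weight_x; case: (weight_state a n).
  by apply: le_trans lx; rewrite ler_pM2r // ler_nat.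
split.
  move=> i ils; rewrite nth_cat -/s; case: ltnP => si; first exact: IHi.
  have il : (i - s < weight_l a n)%N by rewrite ltn_subLR.
  have := same_pair_min (block _ (ltnW il)).
  rewrite (subnKC si) nth_nseq il /eucl_min => -> /=; rewrite min_r //.
  (* One more subtraction still fits inside the block, so the other entry is at least x_n. *)
  have : (i - s).+1%:R * weight_x a n <= (weight_state a n).1.
    by apply: le_trans lx; rewrite ler_pM2r // ler_nat.
  by rewrite -natr1; lra.
have bl := block _ (leqnn _).
have rem0 : 0 <= (weight_state a n).1 - (weight_l a n)%:R * weight_x a n by lra.
(* A zero remainder ends the expansion and is then the minimum of the pair. *)
case: ltP => rem; last first.
  by rewrite /eucl_min (same_pair_min bl) /= min_l; lra.
split; first by lia.
by case: bl => ->; [right | left].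
Qed.

Lemma weight_eucl_min a i : 1 <= a -> weight a i = eucl_min a i.
Proof.
move=> a1; rewrite /weight -/(weight_blocks a i.+1).
have [lt_i ge_i] := weight_blocks_eucl i.+1 a1.
case: (ltnP i (size (weight_blocks a i.+1))) => [/lt_i //|si].
(* Past the list the expansion has ended: the default 0 of [nth] agrees with the minimum, which
   stays 0. *)
rewrite nth_default //; apply/esym/(eucl_min0 _ si); first by lra.
by move: ge_i; case: ltP => // _ []; lia.
Qed.

Lemma eucl_min_weight_length a M :
  1 <= a -> weight_length a = Some M -> eucl_min a M = 0.
Proof.
move=> a1; rewrite /weight_length; case: pselect => // fin_a [].
case: ex_minnP => J /eqP xJ _ lM.
have [_] := weight_blocks_eucl J a1.
by rewrite xJ ltxx size_weight_blocks lM.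
Qed.

End Weights.

(** * Affine formulas for the weights on an interval without early ties *)

Section LinearRegion.
Variable R : realType.
Implicit Types (a z t : R) (J : set R) (b c e f x y : int).

Definition extend (al : nat -> int) (k : nat) x : nat -> int :=
  fun i => if i == k then x else al i.

(** The binary [F] serves both sums of squares and the scalar product of the coefficient vectors. *)
Lemma sum_extend (F : int -> int -> int) (al be : nat -> int) k x y :
  \sum_(i < k.+1) F (extend al k x i) (extend be k y i) =
  \sum_(i < k) F (al i) (be i) + F x y.
Proof.
rewrite big_ord_recr /= /extend eqxx; congr +%R.
by apply: eq_bigr => i _; rewrite ltn_eqF.
Qed.

Lemma extend_ltn (al : nat -> int) k x i : (i < k)%N -> extend al k x i = al i.
Proof. by move=> ik; rewrite /extend ltn_eqF. Qed.

Lemma extend_id (al : nat -> int) k x : extend al k x k = x.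
Proof. by rewrite /extend eqxx. Qed.

(** A tie at step k would make the minimum vanish at k.+1, hence at N. Two points with opposite
    orders would enclose a tie, since the difference of the entries is affine in z. *)
Lemma eucl_linear_sign J N k b c e f :
  is_interval J -> (forall z, J z -> 0 <= z) ->
  (forall z, J z -> 0 < eucl_min z N) -> (k < N)%N -> 0 <= b -> 0 <= f ->
  (forall z, J z ->
     eucl z k = (b%:~R * z - c%:~R, e%:~R - f%:~R * z)) ->
  (forall z, J z -> (eucl z k).2 < (eucl z k).1) \/
  (forall z, J z -> (eucl z k).1 < (eucl z k).2).
Proof.
move=> Jitv J0 JN kN b0 f0 lin.
have neq z : J z -> (eucl z k).1 = (eucl z k).2 -> False.
  move=> Jz xy; have := JN z Jz; rewrite (@eucl_min0 R z k.+1 N) ?J0 ?ltxx //.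
  have [x0 _] := eucl_ge0 k (J0 z Jz).
  by rewrite /eucl_min /= /eucl_step -xy lexx /= subrr min_l.
have cross z z' : J z -> J z' ->
    (eucl z k).1 < (eucl z k).2 -> (eucl z' k).2 < (eucl z' k).1 -> False.
  move=> Jz Jz'; rewrite !lin //= => lt_z lt_z'.
  have [b0' f0'] : 0 <= b%:~R :> R /\ 0 <= f%:~R :> R by rewrite !ler0z.
  (* If [b + f = 0], both entries are constant and their order cannot change. *)
  have bf : 0 < b%:~R + f%:~R :> R.
    rewrite lt_neqAle addr_ge0 // andbT; apply/eqP => bf.
    have bE : b%:~R = 0 :> R by lra.
    have fE : f%:~R = 0 :> R by lra.
    by move: lt_z lt_z'; rewrite bE fE !mul0r; lra.
  (* The point where [b t - c = e - f t]; it lies between z and z'. *)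
  pose t : R := (c%:~R + e%:~R) / (b%:~R + f%:~R).
  have tE : (b%:~R + f%:~R) * t = c%:~R + e%:~R.
    by rewrite /t mulrC divfK // gt_eqF.
  have Jt : J t.
    apply: (Jitv z z') => //; apply/andP; split.
      by rewrite -(ler_pM2l bf) tE; lra.
    by rewrite -(ler_pM2l bf) tE; lra.
  by apply: (neq t Jt); rewrite lin //=; lra.
have [[z [Jz lt_z]]|no] := pselect (exists z, J z /\ (eucl z k).1 < (eucl z k).2).
  right => z' Jz'; case: (ltgtP (eucl z' k).1 (eucl z' k).2) => // h.
    by case: (cross z z').
  by case: (neq z').
left => z Jz; case: (ltgtP (eucl z k).1 (eucl z k).2) => // h.
  by case: no; exists z.
by case: (neq z).
Qed.

(** At each step the same branch is taken on all of J. The three sums are the coefficients in z of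
    the identity [eucl_sum_sqr], simplified by the determinant; they are carried through the
    induction because J may be a single point. *)
Lemma eucl_linear J N :
  is_interval J -> (forall z, J z -> 0 <= z) ->
  (forall z, J z -> 0 < eucl_min z N) ->
  forall k, (k <= N)%N -> exists b c e f : int, exists al be : nat -> int,
  [/\ [/\ 0 <= b, 0 <= c, 0 <= e & 0 <= f], b * e = c * f + 1,
      [/\ \sum_(i < k) al i ^+ 2 = c * e, \sum_(i < k) be i ^+ 2 = b * f &
          \sum_(i < k) al i * be i = - (c * f)] &
      forall z, J z -> eucl z k = (b%:~R * z - c%:~R, e%:~R - f%:~R * z) /\
        forall i, (i < k)%N -> eucl_min z i = (al i)%:~R + (be i)%:~R * z].
Proof.
move=> Jitv J0 JN; elim=> [|k IH] kN.
  exists 1, 0, 1, 0, (fun=> 0), (fun=> 0).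
  split=> //; first by rewrite !big_ord0.
  by move=> z _; split=> //=; congr pair; ring.
have [b [c [e [f [al [be [[b0 c0 e0 f0] det [Saa Sbb Sab] lin]]]]]]] := IH (ltnW kN).
have [] := eucl_linear_sign Jitv J0 JN kN b0 f0 (fun z Jz => (lin z Jz).1) => sgn.
(* The second entry is smaller: [e - f z] is the new weight and is subtracted from the first. *)
- exists (b + f), (c + e), e, f, (extend al k e), (extend be k (- f)).
  split; first by split=> //; exact: addr_ge0.
  + by rewrite mulrDl det; ring.
  + split.
    * by rewrite (sum_extend (fun x _ => x ^+ 2) al be k e (- f)) Saa; ring.
    * by rewrite (sum_extend (fun _ y => y ^+ 2) al be k e (- f)) Sbb; ring.
    * by rewrite (sum_extend *%R al be k e (- f)) Sab; ring.
  move=> z Jz; have lt_z := sgn z Jz; have [zk zi] := lin z Jz; split.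
    rewrite /= -/(eucl z k) /eucl_step ltW // zk /= !rmorphD /=.
    by congr pair; ring.
  move=> i; rewrite ltnS leq_eqVlt => /predU1P[->|ik]; last first.
    by rewrite !extend_ltn // zi.
  by rewrite !extend_id /eucl_min min_r ?ltW // zk /= rmorphN /=; ring.
(* The first entry is smaller: the new weight is [b z - c]. *)
- exists b, c, (e + c), (f + b), (extend al k (- c)), (extend be k b).
  split; first by split=> //; exact: addr_ge0.
  + by rewrite mulrDr det; ring.
  + split.
    * by rewrite (sum_extend (fun x _ => x ^+ 2) al be k (- c) b) Saa; ring.
    * by rewrite (sum_extend (fun _ y => y ^+ 2) al be k (- c) b) Sbb; ring.
    * by rewrite (sum_extend *%R al be k (- c) b) Sab; ring.
  move=> z Jz; have lt_z := sgn z Jz; have [zk zi] := lin z Jz; split.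
    rewrite /= -/(eucl z k) /eucl_step leNgt lt_z /= zk /= !rmorphD /=.
    by congr pair; ring.
  move=> i; rewrite ltnS leq_eqVlt => /predU1P[->|ik]; last first.
    by rewrite !extend_ltn // zi.
  by rewrite !extend_id /eucl_min min_l ?ltW // zk /= rmorphN /=; ring.
Qed.

(** [b P - c Q = 1] makes P and Q coprime, so P/Q and p/q are the same reduced fraction. *)
Lemma coprime_frac_eq (p q : nat) (P Q b c : int) :
  coprime p q -> 0 <= P -> 0 < Q -> b * P = c * Q + 1 -> p%:Z * Q = q%:Z * P ->
  P = p%:Z /\ Q = q%:Z.
Proof.
move=> pq; case: P => // P _; case: Q => // Q Q0 det eqPQ.
have cPQ : coprime P Q.
  have : coprimez P Q.
    by apply/coprimezP; exists (b, - c) => /=; rewrite det; ring.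
  by rewrite /coprimez /gcdz.
have e' : (p * Q = q * P)%N by apply/eqP; rewrite -eqz_nat !PoszM eqPQ.
have qQ : q = Q.
  apply/eqP; rewrite eqn_dvd; apply/andP; split.
    by rewrite -(@Gauss_dvdr q p Q) 1?coprime_sym // e' dvdn_mulr.
  by rewrite -(@Gauss_dvdl Q q P) 1?coprime_sym // -e' dvdn_mull.
subst Q; split=> //; congr Posz; apply/eqP.
by rewrite -(@eqn_pmul2l q) // -e' mulnC.
Qed.

(* The point a is the mediant of c/b and e/f, so its numerator and denominator
   are c + e and b + f; on both sides of a the last weight is the smaller of
   b z - c and e - f z, which differ by p - q z. *)
Lemma eucl_node J N a (p q : nat) :
  is_interval J -> (forall z, J z -> 0 <= z) ->
  (forall z, J z -> 0 < eucl_min z N) -> J a -> eucl_min a N.+1 = 0 ->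
  coprime p q -> (0 < q)%N -> a = p%:R / q%:R ->
  exists b c : int, exists al be : nat -> int,
  [/\ [/\ 0 <= b, 0 <= c, c <= p%:Z & b * p%:Z = c * q%:Z + 1],
      al N = - c /\ be N = b,
      [/\ \sum_(i < N.+1) al i ^+ 2 = c * p%:Z,
          \sum_(i < N.+1) be i ^+ 2 = b * q%:Z &
          \sum_(i < N.+1) al i * be i = - (c * q%:Z)],
      forall z i, J z -> (i < N)%N ->
        eucl_min z i = (al i)%:~R + (be i)%:~R * z &
      forall z, J z ->
        eucl_min z N = Num.min ((- c)%:~R + b%:~R * z)
                          ((- c)%:~R + b%:~R * z + (p%:R - q%:R * z))].
Proof.
move=> Jitv J0 JN Ja a0 pq q0 aE.
have [b [c [e [f [al [be [[b0 c0 e0 f0] det [Saa Sbb Sab] lin]]]]]]] :=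
  eucl_linear Jitv J0 JN (leqnn N).
have q0R : 0 < q%:R :> R by rewrite ltr0n.
(* A positive minimum followed by a zero minimum can only come from a tie. *)
have xy : (eucl a N).1 = (eucl a N).2.
  have := JN a Ja; rewrite lt_min => /andP[].
  move: a0; rewrite /eucl_min /= -/(eucl a N) /eucl_step.
  case: (eucl a N) => x y /=.
  case: (leP y x) => h /=.
    by case: (leP (x - y) y) => h' ? ? ?; lra.
  by case: (leP x (y - x)) => h' ? ? ?; lra.
have eqa : (b + f)%:~R * a = (c + e)%:~R :> R.
  by move: xy; have [-> _] := lin a Ja; rewrite /= !rmorphD /=; lra.
have [pE qE] : c + e = p%:Z /\ b + f = q%:Z.
  apply: (@coprime_frac_eq p q _ _ b c) => //; first exact: addr_ge0.
  (* [b * e = c * f + 1 >= 1] forces [b > 0]. *)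
  - by nia.
  - by rewrite mulrDr det; ring.
  apply/eqP; rewrite -(eqr_int R) !intrM -eqa aE; apply/eqP.
  by rewrite -!pmulrn; field; rewrite gt_eqF.
(* The last weight is recorded by its formula left of a, [b z - c]. *)
exists b, c, (extend al N (- c)), (extend be N b); split.
- split=> //; first by lia.
  by rewrite -pE -qE mulrDr det; ring.
- by rewrite !extend_id.
- split.
  + by rewrite (sum_extend (fun x _ => x ^+ 2) al be N (- c) b) Saa -pE; ring.
  + by rewrite (sum_extend (fun _ y => y ^+ 2) al be N (- c) b) Sbb -qE; ring.
  + by rewrite (sum_extend *%R al be N (- c) b) Sab -qE; ring.
- by move=> z i Jz iN; rewrite !extend_ltn // (lin z Jz).2.
move=> z Jz; rewrite /eucl_min; have [-> _] := lin z Jz.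
have -> : p%:R = (c + e)%:~R :> R by rewrite pE pmulrn.
have -> : q%:R = (b + f)%:~R :> R by rewrite qE pmulrn.
by rewrite /= !rmorphD rmorphN /=; congr Num.min; ring.
Qed.

End LinearRegion.

(** * Consequences of the inequality m . w(z) > D sqrt z *)

Section Obstruction.
Variable R : realType.
Implicit Types (D a z P : R).

(** If the last weight vanished, only the first N entries of m would contribute; their squares sum
    to at most D^2 because m_N >= 1, and Cauchy-Schwarz would bound the product by D sqrt z. *)
Lemma last_weight_gt0 (m : nat -> R) N D z : 0 <= D -> 0 <= z ->
  \sum_(i < N.+1) m i ^+ 2 = D ^+ 2 + 1 -> 1 <= m N ->
  D * Num.sqrt z < \sum_(i < N.+1) m i * eucl_min z i -> 0 < eucl_min z N.
Proof.
move=> D0 z0 sm mN; apply: contraLR.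
rewrite -!leNgt => wN; have {}wN : eucl_min z N = 0.
  by apply: le_anti; rewrite wN eucl_min_ge0.
rewrite big_ord_recr /= wN mulr0 addr0.
have sm' : \sum_(i < N) m i ^+ 2 <= D ^+ 2.
  by move: sm; rewrite big_ord_recr /=; nra.
have CS := sum_mul_sqr_le N m (eucl_min z).
have Dz0 : 0 <= D * Num.sqrt z by rewrite mulr_ge0 // sqrtr_ge0.
rewrite (le_trans (ler_norm _)) // -(ler_pXn2r (n := 2)) ?nnegrE //.
rewrite real_normK ?num_real // exprMn sqr_sqrtr //.
apply: (le_trans CS); apply: ler_pM => //; last exact: eucl_sum_sqr_le.
- by apply: sumr_ge0 => i _; exact: sqr_ge0.
- by apply: sumr_ge0 => i _; exact: sqr_ge0.
Qed.

(* The vector m - (D / sqrt a) w has norm less than 1. *)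
Lemma error_dot_lt (m w v : nat -> R) n D a P : 0 < D -> 0 < a -> 0 < P ->
  \sum_(i < n) m i ^+ 2 = D ^+ 2 + 1 -> \sum_(i < n) w i ^+ 2 <= a ->
  D * Num.sqrt a < \sum_(i < n) m i * w i ->
  \sum_(i < n) v i ^+ 2 <= P ^+ 2 ->
  \sum_(i < n) m i * v i - D / Num.sqrt a * \sum_(i < n) w i * v i < P.
Proof.
move=> D0 a0 P0 sm sw smw sv.
have r0 : 0 < Num.sqrt a by rewrite sqrtr_gt0.
set L := D / Num.sqrt a.
have L0 : 0 < L by rewrite divr_gt0.
have Lr : L * Num.sqrt a = D by rewrite /L divfK ?gt_eqF.
have -> : \sum_(i < n) m i * v i - L * \sum_(i < n) w i * v i =
    \sum_(i < n) (m i - L * w i) * v i.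
  by rewrite mulr_sumr -sumrB; apply: eq_bigr => i _; ring.
have CS := sum_mul_sqr_le n (fun i => m i - L * w i) v.
set S := \sum_(i < n) (m i - L * w i) * v i in CS *.
(* The squared norm is at most D^2 + 1 - 2 L (m . w) + D^2, and L (m . w) > L D sqrt a = D^2. *)
have e1 : \sum_(i < n) (m i - L * w i) ^+ 2 < 1.
  have -> : \sum_(i < n) (m i - L * w i) ^+ 2 = \sum_(i < n) m i ^+ 2
      - 2 * L * \sum_(i < n) m i * w i + L ^+ 2 * \sum_(i < n) w i ^+ 2.
    by rewrite !mulr_sumr -sumrB -big_split /=; apply: eq_bigr => i _; ring.
  have h1 : L * (D * Num.sqrt a) < L * \sum_(i < n) m i * w i.
    by rewrite ltr_pM2l.
  have h2 : L ^+ 2 * \sum_(i < n) w i ^+ 2 <= D ^+ 2.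
    rewrite -Lr [leRHS]exprMn sqr_sqrtr ?(ltW a0) //.
    by apply: ler_wpM2l; rewrite ?sqr_ge0.
  have h3 : L * (D * Num.sqrt a) = D ^+ 2.
    by rewrite mulrCA mulrA -Lr; ring.
  by lra.
have PS : 0 < P ^+ 2 by rewrite exprn_gt0.
case: ltP => // PleS; suff : S ^+ 2 < P ^+ 2.
  by rewrite ltr_pXn2r ?nnegrE ?(ltW P0) ?(le_trans (ltW P0)) // ltNge PleS.
apply: (le_lt_trans CS).
have E0 : 0 <= \sum_(i < n) (m i - L * w i) ^+ 2.
  by apply: sumr_ge0 => i _; exact: sqr_ge0.
apply: (le_lt_trans (ler_wpM2l E0 sv)).
by rewrite -[ltRHS]mul1r ltr_pM2r.
Qed.

End Obstruction.

(** * Entries of an exceptional class, up to trailing zeros *)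

Lemma sumr_ord_cutoff (V : nmodType) (F : nat -> V) n k :
  (forall i, (n <= i)%N -> F i = 0) -> (forall i, (k <= i)%N -> F i = 0) ->
  \sum_(i < n) F i = \sum_(i < k) F i.
Proof.
suff le_case n' k' : (n' <= k')%N -> (forall i, (n' <= i)%N -> F i = 0) ->
    \sum_(i < n') F i = \sum_(i < k') F i.
  move=> Fn Fk; case: (leqP n k) => [/le_case|/ltnW/le_case] E; first exact: E.
  by rewrite E.
move=> nk Fn; rewrite -!(big_mkord xpredT) (@big_cat_nat _ _ _ n' 0 k') //=.
have -> : \sum_(n' <= i < k') F i = 0; last by rewrite addr0.
by rewrite big_nat_cond big1 // => i /andP[/andP[/Fn]].
Qed.

(** The positive entries of a nonincreasing sequence form an initial segment, so their number
    locates the last one. *)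
Lemma nth_gt0_count (m : seq int) i :
  (forall i, 0 <= m`_i.+1 <= m`_i) -> (0 < m`_i) = (i < tuple_length m)%N.
Proof.
rewrite /tuple_length; elim: m i => [|x s IH] i dec /=; first by rewrite nth_nil ltxx.
have decs j : 0 <= s`_j.+1 <= s`_j := dec j.+1.
have [x0|x0] := ltP 0 x.
  by case: i => [|i] /=; rewrite ?x0 ?IH.
have s0 : (0 < s`_0) = false.
  by apply/negbTE; rewrite -leNgt; apply: le_trans x0; have /andP[] := dec 0%N.
(* The induction hypothesis at index 0 turns a nonpositive first entry of [s] into an empty
   count. *)
have cs : count (fun k : int => 0 < k) s = 0%N.
  by move: s0; rewrite IH //; case: count.
by rewrite cs; case: i => [|i] /=; [rewrite ltNge x0 | rewrite IH // cs].
Qed.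

(** [1 <= d] rules out (0; -1, 0, ...); the other classes carry these conditions in their
    definition, up to trailing zeros. *)
Lemma exceptional_coefficients (R : realType) d m :
  exceptional R d m -> 1 <= d ->
  (forall i : nat, 0 <= m`_i.+1 <= m`_i) /\
  \sum_(i < size m) m`_i ^+ 2 = d ^+ 2 + 1.
Proof.
case=> K [m' [[[_ [-> _]] //|[d0 m'0 m'sort self _]] mE]] d1.
have m'_ge0 i : 0 <= m'`_i.
  have [im|im] := ltnP i (size m'); last by rewrite nth_default.
  by apply: (allP m'0); exact: mem_nth.
split=> [i|].
  rewrite !mE m'_ge0 /=; have [im|im] := ltnP i.+1 (size m').
    by apply: (sortedP 0 m'sort).
  by rewrite nth_default // -mE.
have -> : \sum_(i < size m) m`_i ^+ 2 = \sum_(i < size m') m'`_i ^+ 2.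
  rewrite (@sumr_ord_cutoff _ (fun i => m`_i ^+ 2) _ (size m')).
  - by apply: eq_bigr => i _; rewrite mE.
  - by move=> i im; rewrite nth_default // expr0n.
  - by move=> i im; rewrite mE nth_default // expr0n.
move: self; rewrite /self_intersection (big_nth 0) big_mkord.
by move/(congr1 (fun x => d ^+ 2 - x)); rewrite subKr => ->; ring.
Qed.

(** * The two affine pieces and the bounds on A and B *)

Theorem proposition2p3p2 (R : realType) (d : int) (m : seq int)
    (dm_exc : exceptional R d m) (d_ge1 : 1 <= d)
    (a : R) (a_ge1 : 1 <= a)
    (p q : nat) (q_gt0 : (0 < q)%N) (p_q_coprime : coprime p q)
    (a_eq : a = p%:R / q%:R)
    (M : nat) (length_m : tuple_length m = M)
    (length_a : weight_length a = Some M)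
    (mu_a : Num.sqrt a < mu d m a) :
  let mM : int := m`_M.-1 in
  let I : set R :=
    connected_component [set z : R | 1 <= z /\ Num.sqrt z < mu d m z] a in
  exists A B : int,
    [/\ A < p%:Z,
        B < (mM + 1) * q%:Z &
        forall z : R, I z ->
          (z < a -> d%:~R * mu d m z = A%:~R + B%:~R * z) /\
          (a < z -> d%:~R * mu d m z =
                      (A + mM * p%:Z)%:~R + (B - mM * q%:Z)%:~R * z)].
Proof.
move=> mM I.
have [m_dec m_sqr] := exceptional_coefficients dm_exc d_ge1.
have m_gt0 i : (0 < m`_i) = (i < M)%N by rewrite -length_m nth_gt0_count.
have m_eq0 i : (M <= i)%N -> m`_i = 0.
  move=> Mi; apply: le_anti; rewrite leNgt m_gt0 -leqNgt Mi /=.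
  have [im|im] := ltnP i (size m); last by rewrite nth_default.
  by have /andP[h1 h2] := m_dec i; exact: le_trans h2.
have m_default i : (size m <= i)%N -> m`_i = 0 by move=> ?; rewrite nth_default.
have {}m_sqr : \sum_(i < M) m`_i ^+ 2 = d ^+ 2 + 1.
  rewrite -m_sqr; apply: (@sumr_ord_cutoff _ (fun i => m`_i ^+ 2)) => i.
    by move=> /m_eq0 ->; rewrite expr0n.
  by move=> /m_default ->; rewrite expr0n.
case: M @mM length_m length_a m_gt0 m_eq0 m_sqr => [|N] mM _ length_a m_gt0 m_eq0 m_sqr.
  (* [M = 0] would give d^2 + 1 = 0. *)
  by move: m_sqr; rewrite big_ord0; nia.
have mM1 : 1 <= mM by have := m_gt0 N; rewrite ltnSn -/mM; lia.
have d0 : 0 < d%:~R :> R by rewrite ltr0z; lia.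
have muE (z : R) : 1 <= z ->
    d%:~R * mu d m z = \sum_(i < N.+1) (m`_i)%:~R * eucl_min z i.
  move=> z1; rewrite /mu mulVKf ?(gt_eqF d0) //.
  rewrite (@sumr_ord_cutoff _ (fun i => (m`_i)%:~R * weight z i) _ N.+1).
  - by apply: eq_bigr => i _; rewrite weight_eucl_min.
  - by move=> i /m_default ->; rewrite mul0r.
  - by move=> i /m_eq0 ->; rewrite mul0r.
have mRsqr : \sum_(i < N.+1) (m`_i)%:~R ^+ 2 = d%:~R ^+ 2 + 1 :> R.
  have := congr1 (fun x : int => x%:~R : R) m_sqr; rewrite rmorphD rmorphXn /= => <-.
  by rewrite rmorph_sum /=; apply: eq_bigr => i _; rewrite rmorphXn.
have I_itv : is_interval I by apply/connected_intervalP; exact: component_connected.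
have I_sub z : I z -> 1 <= z /\ Num.sqrt z < mu d m z.
  exact: connected_component_sub.
have I_ge0 z : I z -> 0 <= z by move=> /I_sub[z1 _]; lra.
have Ia : I a by exact: connected_component_refl.
have obstr z : I z ->
    d%:~R * Num.sqrt z < \sum_(i < N.+1) (m`_i)%:~R * eucl_min z i.
  by move=> /I_sub[z1 muz]; rewrite -muE // ltr_pM2l.
have I_gt0 z : I z -> 0 < eucl_min z N.
  move=> Iz; apply: (@last_weight_gt0 R (fun i => (m`_i)%:~R) N d%:~R z _
    (I_ge0 z Iz) mRsqr _ (obstr z Iz)); first exact: ltW.
  by rewrite ler1z.
have a0 : eucl_min a N.+1 = 0 by exact: eucl_min_weight_length.
have [b [c [al [be [[b0 c0 cp bpcq] [alN beN] [Saa Sbb Sab] lin lastE]]]]] :=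
  eucl_node I_itv I_ge0 I_gt0 Ia a0 p_q_coprime q_gt0 a_eq.
have qR0 : 0 < q%:R :> R by rewrite ltr0n.
have qa : q%:R * a = p%:R by rewrite a_eq mulrC divfK // gt_eqF.
(* The case [z = a] is included, so these formulas also evaluate w(a). *)
have w_left z i : I z -> z <= a -> (i < N.+1)%N ->
    eucl_min z i = (al i)%:~R + (be i)%:~R * z.
  move=> Iz za; rewrite ltnS leq_eqVlt => /predU1P[->|/lin ->] //.
  rewrite lastE // alN beN min_l // lerDl subr_ge0 -qa.
  by rewrite ler_pM2l.
pose A : int := \sum_(i < N.+1) m`_i * al i.
pose B : int := \sum_(i < N.+1) m`_i * be i.
have AE : A%:~R = \sum_(i < N.+1) (m`_i)%:~R * (al i)%:~R :> R.
  by rewrite rmorph_sum; apply: eq_bigr => i _; rewrite rmorphM.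
have BE : B%:~R = \sum_(i < N.+1) (m`_i)%:~R * (be i)%:~R :> R.
  by rewrite rmorph_sum; apply: eq_bigr => i _; rewrite rmorphM.
have toR (F : nat -> int) x : \sum_(i < N.+1) F i = x ->
    \sum_(i < N.+1) (F i)%:~R = x%:~R :> R by move=> <-; rewrite rmorph_sum.
have SaaR : \sum_(i < N.+1) (al i)%:~R ^+ 2 = c%:~R * p%:R :> R.
  have := toR (fun i => al i ^+ 2) _ Saa; rewrite rmorphM /= => <-.
  by apply: eq_bigr => i _; rewrite rmorphXn.
have SbbR : \sum_(i < N.+1) (be i)%:~R ^+ 2 = b%:~R * q%:R :> R.
  have := toR (fun i => be i ^+ 2) _ Sbb; rewrite rmorphM /= => <-.
  by apply: eq_bigr => i _; rewrite rmorphXn.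
have SabR : \sum_(i < N.+1) (al i)%:~R * (be i)%:~R = - (c%:~R * q%:R) :> R.
  have := toR (fun i => al i * be i) _ Sab; rewrite rmorphN rmorphM /= => <-.
  by apply: eq_bigr => i _; rewrite rmorphM.
have bpcqR : b%:~R * p%:R = c%:~R * q%:R + 1 :> R.
  have := congr1 (fun x : int => x%:~R : R) bpcq.
  by rewrite rmorphD !rmorphM /=.
have p0 : 0 < p%:R :> R by rewrite -qa mulr_gt0 //; lra.
(* |al|^2 + (al . be) a = c p - c q a, and q a = p. *)
have wal : \sum_(i < N.+1) eucl_min a i * (al i)%:~R = 0.
  transitivity (\sum_(i < N.+1) (al i)%:~R ^+ 2
      + (\sum_(i < N.+1) (al i)%:~R * (be i)%:~R) * a).
    rewrite mulr_suml -big_split /=; apply: eq_bigr => i _.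
    by rewrite w_left //; ring.
  by rewrite SaaR SabR -qa; ring.
(* al . be + |be|^2 a = - c q + b q a = b p - c q = 1. *)
have wbe : \sum_(i < N.+1) eucl_min a i * (be i)%:~R = 1.
  transitivity (\sum_(i < N.+1) (al i)%:~R * (be i)%:~R
      + (\sum_(i < N.+1) (be i)%:~R ^+ 2) * a).
    rewrite mulr_suml -big_split /=; apply: eq_bigr => i _.
    by rewrite w_left //; ring.
  by rewrite SbbR SabR -mulrA qa bpcqR; ring.
have wN : q%:R * eucl_min a N = 1.
  by rewrite w_left // alN beN rmorphN /= mulrDr mulrCA qa bpcqR; ring.
have a_gt0 : 0 < a by lra.
have bound v (P : R) P0 := @error_dot_lt R (fun i => (m`_i)%:~R) (eucl_min a) v
  N.+1 d%:~R a P d0 a_gt0 P0 mRsqr (eucl_sum_sqr_le N.+1 (ltW a_gt0)) (obstr a Ia).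
have sum_last (f v : nat -> R) (r : R) :
    \sum_(i < N.+1) f i * (v i - (i == N :> nat)%:R * r) =
    \sum_(i < N.+1) f i * v i - f N * r.
  rewrite !big_ord_recr /= eqxx mul1r mulrBr addrA; congr (_ + _ - _).
  by apply: eq_bigr => i _; rewrite ltn_eqF // mul0r subr0.
exists A, B; split.
- rewrite -(ltr_int R) AE -pmulrn.
  have := bound (fun i => (al i)%:~R) p%:R p0; rewrite wal mulr0 subr0; apply.
  (* |al|^2 = c p is at most p^2 because [c <= p]. *)
  rewrite SaaR expr2 ler_pM2r // pmulrn ler_int //.
- (* Comparing with q e_N cancels the term D / sqrt a, since w_N(a) = 1 / q. *)
  have := bound (fun i : nat => (be i)%:~R - (i == N :> nat)%:R * q%:R) q%:R qR0.
  rewrite (sum_last (fun i => (m`_i)%:~R) (fun i => (be i)%:~R)).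
  rewrite (sum_last (eucl_min a) (fun i => (be i)%:~R)) wbe.
  rewrite [eucl_min a N * _]mulrC wN subrr mulr0 subr0 -BE.
  rewrite mulrDl mul1r -(ltr_int R) rmorphD rmorphM /= -ltrBlDl; apply.
  (* The last entry of [be] is b, so the sum is b q - b^2 + (b - q)^2 = q^2 - b q. *)
  have -> : \sum_(i < N.+1) ((be i)%:~R - (i == N :> nat)%:R * q%:R) ^+ 2 =
      q%:R ^+ 2 - b%:~R * q%:R :> R.
    rewrite big_ord_recr /= eqxx mul1r beN.
    rewrite (eq_bigr (fun i : 'I_N => (be i)%:~R ^+ 2)) => [|i _].
      by move: SbbR; rewrite big_ord_recr /= beN => /(canRL (addrK _)) ->; ring.
    by rewrite ltn_eqF // mul0r subr0.
  by rewrite gerBl mulr_ge0 ?ler0z // ltW.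
move=> z Iz; have [z1 _] := I_sub z Iz; rewrite muE //.
have sum_lin : A%:~R + B%:~R * z =
    \sum_(i < N.+1) (m`_i)%:~R * ((al i)%:~R + (be i)%:~R * z).
  by rewrite AE BE mulr_suml -big_split /=; apply: eq_bigr => i _; ring.
split=> [za|az].
  by rewrite sum_lin; apply: eq_bigr => i _; rewrite w_left // ltW.
(* Right of a only the last weight leaves its left-hand formula, by p - q z. *)
transitivity (A%:~R + B%:~R * z + mM%:~R * (p%:R - q%:R * z)).
  rewrite sum_lin !big_ord_recr /= lastE // -alN -beN min_r.
    rewrite [_ * (_ + (p%:R - _))]mulrDr addrA; congr (_ + _ + _).
    by apply: eq_bigr => i _; rewrite lin.
  by rewrite gerDl subr_le0 -qa ler_pM2l // ltW.
by rewrite rmorphD rmorphB !rmorphM /=; ring.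
Qed.
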